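(* Let $\mathbb F\in\{\mathbb F_4,\mathbb F_8,\mathbb F_9\}$ with prime subfield $\mathbb F_0$, and let $Q(6,\mathbb F)$ be the polar space of $q(x_1,\dots,x_7)=x_1x_2+x_3x_4+x_5x_6+x_7^2$ on $\mathbb F^7$. Then the line-Grassmannian $Q_2(6,\mathbb F)$ is generated over $\mathbb F_0$.
   Context: $Q_2(6,\mathbb F)$ has as points the totally singular 2-dimensional subspaces of $\mathbb F^7$ and as lines the sets $\{Z: X\subset Z\subset Y\}$ with $X$ totally singular of dimension 1 and $Y$ totally singular of dimension 3, $X\subset Y$. The same polynomial defines a form on $\mathbb F_0^7$; each totally singular 2-dimensional $\mathbb F_0$-subspace $L$ gives the point $\langle L\rangle_{\mathbb F}$ of $Q_2(6,\mathbb F)$. ''Generated over $\mathbb F_0$'' means that the set of all such points generates $Q_2(6,\mathbb F)$, i.e. the smallest set of points containing it and containing every line that meets it in at least two points is all of $Q_2(6,\mathbb F)$. *)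

(* Defs.v *)
From HB Require Import structures.
From mathcomp Require Import all_boot all_order all_algebra all_field.
Set Implicit Arguments. Unset Strict Implicit. Unset Printing Implicit Defensive.
Import GRing.Theory.
Local Open Scope ring_scope.

Definition qform (R : comNzRingType) (x : 'rV[R]_7) : R :=
  x 0 (inord 0) * x 0 (inord 1) + x 0 (inord 2) * x 0 (inord 3)
  + x 0 (inord 4) * x 0 (inord 5) + x 0 (inord 6) ^+ 2.

Definition tot_sing (K : finFieldType) (A : 'M[K]_7) : bool :=
  [forall v : 'rV[K]_7, (v <= A)%MS ==> (qform v == 0)].

(* Subspaces are represented canonically by <<A>>%MS. *)
Definition is_subsp (K : fieldType) (A : 'M[K]_7) : bool := A == <<A>>%MS.

Definition Q2points (K : finFieldType) : {set 'M[K]_7} :=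
  [set A | [&& is_subsp A, \rank A == 2%N & tot_sing A]].

Definition Q2line (K : finFieldType) (X Y : 'M[K]_7) : {set 'M[K]_7} :=
  [set Z in Q2points K | (X <= Z)%MS && (Z <= Y)%MS].

Definition is_Q2line (K : finFieldType) (l : {set 'M[K]_7}) : Prop :=
  exists X Y : 'M[K]_7,
    [/\ tot_sing X /\ \rank X = 1%N, tot_sing Y /\ \rank Y = 3%N, (X <= Y)%MS
      & l = Q2line X Y].

Definition Q2subspace (K : finFieldType) (S : {set 'M[K]_7}) : Prop :=
  forall l, is_Q2line l -> (1 < #|l :&: S|)%N -> l \subset S.

(* Embedding of the prime field 'F_p into K (a ring morphism when p = char K). *)
Definition Fp_emb (K : fieldType) (p : nat) (x : 'F_p) : K := (x : nat)%:R.

Definition Fp_points (K : finFieldType) (p : nat) : {set 'M[K]_7} :=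
  [set <<map_mx (@Fp_emb K p) L>>%MS | L in
     [set L : 'M['F_p]_7 | (\rank L == 2%N) && tot_sing L]].

Definition generated_over_prime (K : finFieldType) (p : nat) : Prop :=
  forall S : {set 'M[K]_7}, S \subset Q2points K ->
    Fp_points K p \subset S -> Q2subspace S -> S = Q2points K.

(* Main.v *)
(* Call a singular vector x good if every totally singular line on x lies in the
   given subspace S; the lines of S on x form a subspace of the generalized
   quadrangle x^perp / x, which is everything as soon as it contains a grid and
   one point off the grid (good_criterion).

   If x is singular with first coordinate x_1 <> 0, then projecting the rational
   singular lines through e_2 onto x^perp gives an isometric copy of the rational
   Q(4, F_0) in x^perp / x.  Hence x is good if it is rational, and also if all
   points of those rational lines are good.  By rational isometries it remains to
   treat e_1 + t e_3.  Rational points being good, the lines joining e_1 + t e_3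
   to the points of {e_1, e_3}^perp are in S, so one more line is enough.  The
   point y = (1, t, 0, -1, 0, 0, r), with r^2 = -t, is collinear with e_1 + t e_3
   and is itself good whenever the rational part of y^perp contains a Q(4, F_0).
   In characteristic 2 this works for all t; in F_9 it works for t^2 = -1 and
   r = 1 + t, and all other t are obtained by rational shifts. *)
Require Import Defs.
From HB Require Import structures.
From mathcomp Require Import all_boot all_order all_algebra all_field.
From mathcomp Require Import ring.
Set Implicit Arguments. Unset Strict Implicit. Unset Printing Implicit Defensive.
Import GRing.Theory.
Local Open Scope ring_scope.

Local Notation "v # k" := (v 0 (inord k)) (at level 2, format "v # k").

(** * Coordinates and the polar form *)

Definition vec7 (R : nzRingType) (s : seq R) : 'rV[R]_7 := \row_i s`_i.

Lemma eq_vec7 (R : nzRingType) (u v : 'rV[R]_7) :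
  u#0 = v#0 -> u#1 = v#1 -> u#2 = v#2 -> u#3 = v#3 -> u#4 = v#4 ->
  u#5 = v#5 -> u#6 = v#6 -> u = v.
Proof.
move=> h0 h1 h2 h3 h4 h5 h6; apply/rowP=> i.
have: i = inord i by rewrite inord_val.
by case: i => [[|[|[|[|[|[|[|]]]]]]]] //= Hi ->.
Qed.

Definition polar (R : comNzRingType) (x y : 'rV[R]_7) : R :=
  qform (x + y) - qform x - qform y.

Lemma polarE (R : comNzRingType) (x y : 'rV[R]_7) :
  polar x y = x#0 * y#1 + x#1 * y#0 + x#2 * y#3 + x#3 * y#2
              + x#4 * y#5 + x#5 * y#4 + (x#6 * y#6) *+ 2.
Proof. by rewrite /polar /qform !mxE; ring. Qed.

Lemma polarC (R : comNzRingType) (x y : 'rV[R]_7) : polar x y = polar y x.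
Proof. by rewrite !polarE; ring. Qed.

Lemma polar_comb (R : comNzRingType) (x y z : 'rV[R]_7) k l :
  polar x (k *: y + l *: z) = k * polar x y + l * polar x z.
Proof. by rewrite !polarE !mxE; ring. Qed.

Lemma polarxx (R : comNzRingType) (x : 'rV[R]_7) : polar x x = qform x *+ 2.
Proof. by rewrite polarE /qform; ring. Qed.

Lemma polarD (R : comNzRingType) (x y z : 'rV[R]_7) :
  polar x (y + z) = polar x y + polar x z.
Proof. by rewrite !polarE !mxE; ring. Qed.

Lemma polarZ (R : comNzRingType) (x y : 'rV[R]_7) k :
  polar x (k *: y) = k * polar x y.
Proof. by rewrite !polarE !mxE; ring. Qed.

Lemma polarDl (R : comNzRingType) (x y z : 'rV[R]_7) :
  polar (y + z) x = polar y x + polar z x.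
Proof. by rewrite !polarE !mxE; ring. Qed.

Lemma polarZl (R : comNzRingType) (x y : 'rV[R]_7) k :
  polar (k *: y) x = k * polar y x.
Proof. by rewrite !polarE !mxE; ring. Qed.

Lemma qform_comb (R : comNzRingType) (y z : 'rV[R]_7) k l :
  qform (k *: y + l *: z) = k ^+ 2 * qform y + l ^+ 2 * qform z + k * l * polar y z.
Proof. by rewrite polarE /qform !mxE; ring. Qed.

Lemma qformD (R : comNzRingType) (y z : 'rV[R]_7) :
  qform (y + z) = qform y + qform z + polar y z.
Proof. by rewrite polarE /qform !mxE; ring. Qed.

Lemma qformZ (R : comNzRingType) (y : 'rV[R]_7) k : qform (k *: y) = k ^+ 2 * qform y.
Proof. by rewrite /qform !mxE; ring. Qed.

(** * Collinearity relations and good vectors *)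

Definition rational_vec (F : fieldType) (x : 'rV[F]_7) : Prop :=
  exists s : 'rV[int]_7, x = map_mx intr s.

(* A zero or dependent pair counts as collinear, so that the pencil axiom
   needs no independence hypotheses. *)
Definition collinearity (F : fieldType) (L : 'rV[F]_7 -> 'rV[F]_7 -> Prop) : Prop :=
  [/\ forall x y, L x y -> [/\ qform x = 0, qform y = 0 & polar x y = 0],
      forall x y, L x y -> L y x,
      forall x, qform x = 0 -> L x x,
      forall x y z k l, L x y -> L x z -> polar y z = 0 -> L x (k *: y + l *: z)
    & forall x y, rational_vec x -> rational_vec y ->
        qform x = 0 -> qform y = 0 -> polar x y = 0 -> L x y].

Definition good_for (F : fieldType) (L : 'rV[F]_7 -> 'rV[F]_7 -> Prop) x : Prop :=
  forall y, qform y = 0 -> polar x y = 0 -> L x y.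

(** Quantifying over all [L] makes goodness invariant under rational isometries: pulling [L] back
    along one gives another collinearity, while a single subspace need not have such symmetry. *)
Definition good (F : fieldType) (x : 'rV[F]_7) : Prop :=
  forall L, collinearity L -> good_for L x.

Definition rational_isometry (F : fieldType) (f : 'rV[F]_7 -> 'rV[F]_7) : Prop :=
  [/\ forall k l y z, f (k *: y + l *: z) = k *: f y + l *: f z,
      forall v, qform (f v) = qform v,
      forall v, rational_vec v -> rational_vec (f v)
    & forall v, exists u, f u = v].

Section Good.
Variable F : fieldType.
Implicit Types (x y a b c v : 'rV[F]_7).

Lemma good_isometry f x : rational_isometry f -> good x -> good (f x).
Proof.
move=> [flin fq frat fsurj] gx L [L1 L2 L3 L4 L5] y qy xy.
have fpol u v : polar (f u) (f v) = polar u v.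
  by have := flin 1 1 u v; rewrite /polar !scale1r => <-; rewrite !fq.
case: (fsurj y) qy xy => u <-{y}; rewrite fq fpol => qu xu.
apply: (gx (fun u v => L (f u) (f v))) => //; split.
- by move=> z v /L1; rewrite !fq fpol.
- by move=> z v; apply: L2.
- by move=> z qz; apply: L3; rewrite fq.
- by move=> z v w k l Lv Lw vw; rewrite flin; apply: L4; rewrite ?fpol.
- by move=> z v rz rv qz qv zv; apply: L5; rewrite ?fq ?fpol //; apply: frat.
Qed.

Lemma collinearity_scale L (x y : 'rV[F]_7) k :
  collinearity L -> L x y -> L x (k *: y).
Proof.
move=> [L1 _ L3 L4 _] Ly; have [qx qy xy] := L1 _ _ Ly.
(* The second vector of the pencil is [x] itself, with coefficient 0. *)
rewrite -[k *: y]addr0 -[0 : 'rV_7](scale0r x).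
by apply: L4 => //; [exact: L3 | rewrite polarC].
Qed.

(** * Filling the quadrangle from a grid and one point off it *)

Section Criterion.
Variables (L : 'rV[F]_7 -> 'rV[F]_7 -> Prop) (x a a' b b' c : 'rV[F]_7).
Hypothesis LL : collinearity L.
Hypotheses (La : L x a) (La' : L x a') (Lb : L x b) (Lb' : L x b').
Hypotheses (aa' : polar a a' = 1) (bb' : polar b b' = 1).
Hypotheses (ab : polar a b = 0) (ab' : polar a b' = 0).
Hypotheses (a'b : polar a' b = 0) (a'b' : polar a' b' = 0).
Hypotheses (ca : polar c a = 0) (ca' : polar c a' = 0).
Hypotheses (cb : polar c b = 0) (cb' : polar c b' = 0).
Hypothesis qc : qform c != 0.
Hypothesis Lz : L x (c + a - qform c *: a').

Let qa : qform a = 0. Proof. by case: LL => h _ _ _ _; case: (h _ _ La). Qed.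
Let qa' : qform a' = 0. Proof. by case: LL => h _ _ _ _; case: (h _ _ La'). Qed.
Let qb : qform b = 0. Proof. by case: LL => h _ _ _ _; case: (h _ _ Lb). Qed.
Let qb' : qform b' = 0. Proof. by case: LL => h _ _ _ _; case: (h _ _ Lb'). Qed.

(** Here q takes the value k k' + l l', so the singular vectors form a hyperbolic quadric, the
    grid. *)
Let grid k l k' l' : 'rV[F]_7 := (k *: a + l *: b) + (k' *: a' + l' *: b').

Let pE := (polarD, polarDl, polarZ, polarZl, aa', bb', ab, ab', a'b, a'b',
  polarC a' a, polarC b' b, polarC b a, polarC b a', polarC b' a, polarC b' a',
  polarC a c, polarC a' c, polarC b c, polarC b' c, ca, ca', cb, cb',
  polarxx, qa, qa', qb, qb').

Let L_pencil y z : L x y -> L x z -> polar y z = 0 -> L x (y + z).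
Proof.
case: LL => _ _ _ h _ Ly Lz0 yz.
by rewrite -[y]scale1r -[z]scale1r; apply: h.
Qed.

Let L_scale k y : L x y -> L x (k *: y).
Proof. exact: collinearity_scale. Qed.

(** The two halves lie on the lines a b and a' b', and the hypothesis makes them orthogonal. *)
Let grid_L k l k' l' : k * k' + l * l' = 0 -> L x (grid k l k' l').
Proof.
move=> h; apply: L_pencil; last by rewrite !pE -[RHS]h; ring.
- by apply: L_pencil; rewrite ?pE ?mulr0 //; apply: L_scale.
- by apply: L_pencil; rewrite ?pE ?mulr0 //; apply: L_scale.
Qed.

(* Off the grid, two points differing by an orthogonal grid vector are
   simultaneously in the subspace: these moves are the elementary row and
   column operations on ((k, l), (- l', k')), a matrix of determinant - q(c). *)
Let move_L k l k' l' m n m' n' :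
  m * m' + n * n' = 0 -> k * m' + l * n' + k' * m + l' * n = 0 ->
  L x (grid (k + m) (l + n) (k' + m') (l' + n') + c) -> L x (grid k l k' l' + c).
Proof.
move=> h1 h2 h.
have -> : grid k l k' l' + c =
    grid (k + m) (l + n) (k' + m') (l' + n') + c + grid (- m) (- n) (- m') (- n').
  by apply/rowP=> i; rewrite !mxE; ring.
apply: L_pencil => //; first by apply: grid_L; rewrite !mulrNN.
rewrite /grid !pE; transitivity (- (k * m' + l * n' + k' * m + l' * n) - (m * m' + n * n') *+ 2).
  by ring.
by rewrite h1 h2 mul0rn subr0 oppr0.
Qed.

Let off_grid_L0 k l k' l' : l' != 0 -> k * k' + l * l' = - qform c ->
  L x (grid k l k' l' + c).
Proof.
move=> l'0 h.
(* With l' as pivot, three moves bring k to 1, then l to 0, then l' to 0, ending at the point of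
   [Lz]. *)
pose s := (1 - k) / l'; pose l1 := l - s * k'.
have hs : k + s * l' = 1 by rewrite /s; field.
have h1 : k' + l1 * l' = - qform c.
  by rewrite -h /l1 -[k' in LHS]mul1r -{1}hs; ring.
apply: (@move_L _ _ _ _ (s * l') (- (s * k')) 0 0); [by ring | by ring |].
rewrite hs addr0 addr0 -/l1.
apply: (@move_L _ _ _ _ 0 (- l1) (l1 * l') 0); [by ring | by ring |].
rewrite h1 !addr0 subrr.
apply: (@move_L _ _ _ _ 0 0 0 (- l')); [by ring | by ring |].
rewrite !addr0 subrr.
by have -> : grid 1 0 (- qform c) 0 + c = c + a - qform c *: a'
  by apply/rowP=> i; rewrite !mxE; ring.
Qed.

Let off_grid_L k l k' l' : k * k' + l * l' = - qform c -> L x (grid k l k' l' + c).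
Proof.
have [-> h|l'0] := eqVneq l' 0; last exact: off_grid_L0.
(* Now k k' = - q(c) is nonzero, so a move can replace l' = 0 by the pivot k. *)
have k0 : k != 0.
  by apply/eqP=> k0; move: qc; rewrite -oppr_eq0 -h k0 mul0r mulr0 addr0 eqxx.
apply: (@move_L _ _ _ _ 0 0 (- l) k); [by ring | by ring |].
by rewrite !addr0 add0r; apply: off_grid_L0 => //; rewrite -h; ring.
Qed.

(** Modulo [x], a singular [v] is a grid vector plus m c. Either m = 0 and it lies on the grid, or
    it scales to m = 1 and the moves connect it to the point of [Lz]. *)
Lemma good_criterion :
  (forall v, polar x v = 0 -> exists k0 k l k' l' m,
     v = k0 *: x + (k *: a + l *: b + (k' *: a' + l' *: b') + m *: c)) ->
  good_for L x.
Proof.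
move=> span v qv xv; case: (LL) => L1 _ L3 L4 _.
have [qx _ xa] := L1 _ _ La; have [_ _ xa'] := L1 _ _ La'.
have [_ _ xb] := L1 _ _ Lb; have [_ _ xb'] := L1 _ _ Lb'.
have xc : polar x c = 0.
  have [_ _] := L1 _ _ Lz.
  by rewrite -scaleNr !polarD polarZ xa xa' mulr0 !addr0.
have [k0 [k [l [k' [l' [m dv]]]]]] := span _ xv; rewrite {span}dv in qv *.
have xg : polar x (grid k l k' l') = 0 by rewrite !(polarD, polarZ) xa xa' xb xb'; ring.
have qg : k * k' + l * l' + m ^+ 2 * qform c = 0.
  move: qv; rewrite -/(grid k l k' l') [in X in X = 0]qformD qformZ qx mulr0 add0r.
  rewrite polarZl polarD xg polarZ xc mulr0 !addr0 mulr0 addr0 => <-.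
  by rewrite !(qformD, qformZ) !pE; ring.
suff h : L x (grid k l k' l' + m *: c).
  rewrite -/(grid k l k' l'); apply: L_pencil => //; first by apply: L_scale; apply: L3.
  by rewrite polarZl polarD xg polarZ xc mulr0 addr0 mulr0.
have [m0|m0] := eqVneq m 0.
  by rewrite m0 scale0r addr0; apply: grid_L; rewrite -[RHS]qg m0; ring.
have -> : grid k l k' l' + m *: c = m *: (grid (k / m) (l / m) (k' / m) (l' / m) + c).
  by apply/rowP=> i; rewrite !mxE; field.
apply/L_scale/off_grid_L.
have -> : k / m * (k' / m) + l / m * (l' / m) = (k * k' + l * l') / m ^+ 2 by field.
by move/eqP: qg; rewrite addr_eq0 => /eqP ->; field.
Qed.
End Criterion.
End Good.

Ltac coords := rewrite ?polarE /qform /vec7 ?mxE ?inordK //=.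
Ltac vec7_eq := apply: eq_vec7; coords.

(** * Rational isometries and projected frames *)

Section Isometries.
Variable F : fieldType.

Lemma rational_vec7 (s : seq int) : rational_vec (vec7 (map intr s) : 'rV[F]_7).
Proof.
exists (vec7 s); apply/rowP=> i; rewrite !mxE.
have [si|si] := ltnP i (size s); first by rewrite (nth_map 0).
by rewrite !nth_default ?size_map.
Qed.

Definition swap_hyperbolic (v : 'rV[F]_7) : 'rV[F]_7 :=
  vec7 [:: v#1; v#0; v#2; v#3; v#4; v#5; v#6].
Definition swap_pairs12 (v : 'rV[F]_7) : 'rV[F]_7 :=
  vec7 [:: v#2; v#3; v#0; v#1; v#4; v#5; v#6].
Definition swap_pairs13 (v : 'rV[F]_7) : 'rV[F]_7 :=
  vec7 [:: v#4; v#5; v#2; v#3; v#0; v#1; v#6].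
(** Sends e_1 + t e_3 to e_1 + (t + n) e_3. *)
Definition shift (n : int) (v : 'rV[F]_7) : 'rV[F]_7 :=
  vec7 [:: v#0; v#1 - n%:~R * v#3; v#2 + n%:~R * v#0; v#3; v#4; v#5; v#6].
(** A Siegel transformation fixing e_4; for m = 1 it sends e_3 to e_3 - e_4 + e_7. *)
Definition siegel (m : int) (v : 'rV[F]_7) : 'rV[F]_7 :=
  vec7 [:: v#0; v#1; v#2; v#3 - m%:~R ^+ 2 * v#2 - (m%:~R * v#6) *+ 2; v#4; v#5;
           v#6 + m%:~R * v#2].

Ltac rational_image w :=
  let s := fresh "s" in
  move=> _ [s ->]; exists (w s); vec7_eq; rewrite ?(rmorphD, rmorphB, rmorphN, rmorphM, rmorphMn, rmorphXn) //=.

Lemma swap_hyperbolicP : rational_isometry swap_hyperbolic.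
Proof.
split=> [k l y z|v||v].
- by vec7_eq.
- by coords; ring.
- by rational_image (fun v : 'rV[int]_7 => vec7 [:: v#1; v#0; v#2; v#3; v#4; v#5; v#6]).
- by exists (swap_hyperbolic v); vec7_eq.
Qed.

Lemma swap_pairs12P : rational_isometry swap_pairs12.
Proof.
split=> [k l y z|v||v].
- by vec7_eq.
- by coords; ring.
- by rational_image (fun v : 'rV[int]_7 => vec7 [:: v#2; v#3; v#0; v#1; v#4; v#5; v#6]).
- by exists (swap_pairs12 v); vec7_eq.
Qed.

Lemma swap_pairs13P : rational_isometry swap_pairs13.
Proof.
split=> [k l y z|v||v].
- by vec7_eq.
- by coords; ring.
- by rational_image (fun v : 'rV[int]_7 => vec7 [:: v#4; v#5; v#2; v#3; v#0; v#1; v#6]).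
- by exists (swap_pairs13 v); vec7_eq.
Qed.

Lemma shiftP n : rational_isometry (shift n).
Proof.
split=> [k l y z|v||v].
- by vec7_eq; ring.
- by coords; ring.
- by rational_image (fun v : 'rV[int]_7 =>
    vec7 [:: v#0; v#1 - n * v#3; v#2 + n * v#0; v#3; v#4; v#5; v#6]).
- by exists (shift (- n) v); vec7_eq; rewrite rmorphN; ring.
Qed.

Lemma siegelP m : rational_isometry (siegel m).
Proof.
split=> [k l y z|v||v].
- by vec7_eq; ring.
- by coords; ring.
- by rational_image (fun v : 'rV[int]_7 =>
    vec7 [:: v#0; v#1; v#2; v#3 - m ^+ 2 * v#2 - (m * v#6) *+ 2; v#4; v#5; v#6 + m * v#2]).
- by exists (siegel (- m) v); vec7_eq; rewrite ?rmorphN; ring.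
Qed.

(** If the first six coordinates vanish, q is the square of the last one, so a singular vector is 0;
    otherwise swaps bring a nonzero coordinate to the front. *)
Lemma first_coord_ind (P : 'rV[F]_7 -> Prop) :
  (forall x, P (swap_hyperbolic x) -> P x) ->
  (forall x, P (swap_pairs12 x) -> P x) ->
  (forall x, P (swap_pairs13 x) -> P x) ->
  P 0 -> (forall x, qform x = 0 -> x#0 != 0 -> P x) ->
  forall x, qform x = 0 -> P x.
Proof.
move=> Ph P12 P13 P0 P1.
have P2 x : qform x = 0 -> (x#0 != 0) || (x#1 != 0) -> P x.
  move=> qx /orP[/(P1 x qx)//|x1]; apply/Ph/P1; last by coords.
  by case: swap_hyperbolicP => _ -> _ _.
move=> x qx; have [h|] := boolP ((x#0 != 0) || (x#1 != 0)); first exact: P2.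
rewrite negb_or !negbK => /andP[/eqP x0 /eqP x1].
have [h|] := boolP ((x#2 != 0) || (x#3 != 0)).
  by apply/P12/P2; [case: swap_pairs12P => _ -> _ _ | coords].
rewrite negb_or !negbK => /andP[/eqP x2 /eqP x3].
have [h|] := boolP ((x#4 != 0) || (x#5 != 0)).
  by apply/P13/P2; [case: swap_pairs13P => _ -> _ _ | coords].
rewrite negb_or !negbK => /andP[/eqP x4 /eqP x5].
suff -> : x = 0 by [].
have x6 : x#6 = 0.
  by apply/eqP; move/eqP: qx; rewrite /qform x0 x2 x4 !mul0r !add0r expf_eq0.
by vec7_eq.
Qed.

Lemma good_swap_hyperbolic x : good (swap_hyperbolic x) -> good x.
Proof.
move/(good_isometry swap_hyperbolicP).
by have -> : swap_hyperbolic (swap_hyperbolic x) = x by vec7_eq.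
Qed.

Lemma good_swap_pairs12 x : good (swap_pairs12 x) -> good x.
Proof.
move/(good_isometry swap_pairs12P).
by have -> : swap_pairs12 (swap_pairs12 x) = x by vec7_eq.
Qed.

Lemma good_swap_pairs13 x : good (swap_pairs13 x) -> good x.
Proof.
move/(good_isometry swap_pairs13P).
by have -> : swap_pairs13 (swap_pairs13 x) = x by vec7_eq.
Qed.

Lemma good0 : good (0 : 'rV[F]_7).
Proof.
move=> L [_ L2 L3 L4 _] y qy _; apply: L2.
have Ly := L3 y qy; have := L4 y y y 0 0 Ly Ly.
by rewrite !scale0r addr0 polarxx qy mul0rn; apply.
Qed.

(* The projection onto the perp of x of the rational line spanned by
   (0, 1, 0, 0, 0, 0, 0) and (0, 0, s). *)
Definition line_proj (x : 'rV[F]_7) (s : seq F) : 'rV[F]_7 :=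
  vec7 [:: 0, - (polar x (vec7 [:: 0, 0 & s]) / x#0) & s].

(** Since the first coordinates are 0, the second ones affect neither q nor the polar form, so the
    projected frame is still hyperbolic with q(c) = 1. The last list is the off-grid point c + a -
    a'. *)
Lemma good_for_line_proj L (x : 'rV[F]_7) :
  collinearity L -> qform x = 0 -> x#0 != 0 ->
  (forall s, s \in [:: [:: 1; 0; 0; 0; 0]; [:: 0; 1; 0; 0; 0];
       [:: 0; 0; 1; 0; 0]; [:: 0; 0; 0; 1; 0]; [:: 1; -1; 0; 0; 1]] ->
     L x (line_proj x s)) ->
  good_for L x.
Proof.
move=> LL qx x0 h.
pose c := line_proj x [:: 0; 0; 0; 0; 1].
have qc : qform c = 1 by coords; ring.
apply: (@good_criterion F L x (line_proj x [:: 1; 0; 0; 0; 0])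
  (line_proj x [:: 0; 1; 0; 0; 0]) (line_proj x [:: 0; 0; 1; 0; 0])
  (line_proj x [:: 0; 0; 0; 1; 0]) c) => //;
  try (by apply: h; rewrite !inE eqxx ?orbT); try (by coords; ring).
- by rewrite qc oner_eq0.
- have -> : c + line_proj x [:: 1; 0; 0; 0; 0]
      - qform c *: line_proj x [:: 0; 1; 0; 0; 0] = line_proj x [:: 1; -1; 0; 0; 1].
    by rewrite qc; vec7_eq; rewrite ?polarE; coords; field.
  by apply: h; rewrite !inE eqxx ?orbT.
(* Only [x] has a nonzero first coordinate, which fixes its coefficient; the last five coordinates
   give the others, and the second is forced by orthogonality to [x]. *)
move=> v; rewrite polarE => xv; pose k := v#0 / x#0.
exists k, (v#2 - k * x#2), (v#4 - k * x#4), (v#3 - k * x#3), (v#5 - k * x#5), (v#6 - k * x#6).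
vec7_eq; try by rewrite /k; field.
have x1 : x#1 = - (x#2 * x#3 + x#4 * x#5 + x#6 ^+ 2) / x#0.
  apply: (mulIf x0); rewrite divfK //; apply/eqP.
  by rewrite -subr_eq0 -qx /qform; apply/eqP; ring.
have v1 : v#1 = - (x#1 * v#0 + x#2 * v#3 + x#3 * v#2 + x#4 * v#5 + x#5 * v#4
     + (x#6 * v#6) *+ 2) / x#0.
  apply: (mulIf x0); rewrite divfK //; apply/eqP.
  by rewrite -subr_eq0 -xv; apply/eqP; ring.
by coords; rewrite /k v1 x1; field.
Qed.

End Isometries.

(** * Reduction of goodness to the points e_1 + t e_3 *)

Section GoodPoints.
Variable F : fieldType.
Implicit Types (x y v : 'rV[F]_7).

Lemma polar_line_proj x (s1 s2 s3 s4 s5 : F) :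
  x#0 != 0 -> polar x (line_proj x [:: s1; s2; s3; s4; s5]) = 0.
Proof. by move=> x0; rewrite polarE; coords; rewrite polarE; coords; field. Qed.

(** The factor [x#0] clears the denominator of the projection, so that the rational axiom applies to
    it. *)
Lemma rational_line_proj x (s1 s2 s3 s4 s5 : int) : x#0 != 0 -> rational_vec x ->
  rational_vec (x#0 *: line_proj x [seq i%:~R | i <- [:: s1; s2; s3; s4; s5]]).
Proof.
move=> x0 [s dx]; exists (vec7 [:: 0; - polar s (vec7 [:: 0; 0; s1; s2; s3; s4; s5]);
  s#0 * s1; s#0 * s2; s#0 * s3; s#0 * s4; s#0 * s5]).
have d k : x#k = (s#k)%:~R by rewrite dx mxE.
vec7_eq; rewrite ?polarE; coords; rewrite ?mulr0 ?d ?rmorphM //=.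
rewrite !(rmorphD, rmorphN, rmorphM, rmorphMn, rmorph0) /= -!d.
by field; exact: x0.
Qed.

Lemma good_rational x : qform x = 0 -> rational_vec x -> good x.
Proof.
move: x; apply: first_coord_ind => [x IH rx|x IH rx|x IH rx|_|x qx x0 rx L LL].
- by apply: good_swap_hyperbolic; apply: IH; case: (swap_hyperbolicP F) => _ _ h _; apply: h.
- by apply: good_swap_pairs12; apply: IH; case: (swap_pairs12P F) => _ _ h _; apply: h.
- by apply: good_swap_pairs13; apply: IH; case: (swap_pairs13P F) => _ _ h _; apply: h.
- exact: good0.
have key (s1 s2 s3 s4 s5 : int) :
    let s := [seq i%:~R | i <- [:: s1; s2; s3; s4; s5]] in
    qform (line_proj x s) = 0 -> L x (line_proj x s).
  move=> s qs; rewrite -[line_proj x s](scalerK x0).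
  apply: collinearity_scale => //; case: (LL) => _ _ _ _; apply=> //.
  - exact: rational_line_proj.
  - by rewrite qformZ qs mulr0.
  - by rewrite polarZ polar_line_proj ?mulr0.
apply: good_for_line_proj => // s.
rewrite !inE => /or4P[|||/orP[|]] /eqP->.
- by apply: (key 1 0 0 0 0); coords; ring.
- by apply: (key 0 1 0 0 0); coords; ring.
- by apply: (key 0 0 1 0 0); coords; ring.
- by apply: (key 0 0 0 1 0); coords; ring.
- by apply: (key 1 (-1) 0 0 1); coords; ring.
Qed.

Lemma good_for_rational L y v : collinearity L -> qform y = 0 ->
  qform v = 0 -> rational_vec v -> polar y v = 0 -> L y v.
Proof.
move=> LL qy qv rv yv; case: (LL) => _ L2 _ _ _; apply: L2.
by apply: good_rational => //; rewrite polarC.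
Qed.

(* The rational span of this point y is so small that the rational part of its
   perp, generated by the five vectors of the frame below, is a full Q(4, F_0). *)
Lemma good_small_span (t r : F) (m n : int) :
  r ^+ 2 = - t -> m%:~R + n%:~R * t + r *+ 2 = 0 -> (m * n + 1)%:~R != 0 :> F ->
  good (vec7 [:: 1; t; 0; -1; 0; 0; r]).
Proof.
move=> rt mn mn0 L LL; set y := vec7 _.
have dt : t = - r ^+ 2 by rewrite rt opprK.
have dm : m%:~R = - (n%:~R * t) - r *+ 2 :> F.
  by apply/eqP; rewrite -subr_eq0 -mn; apply/eqP; ring.
have qy : qform y = 0 by coords; rewrite dt; ring.
have dmn : (m * n + 1)%:~R = (1 - n%:~R * r) ^+ 2 :> F.
  by rewrite rmorphD rmorphM /= dm dt; ring.
have nr0 : 1 - n%:~R * r != 0 by move: mn0; rewrite dmn expf_eq0.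
(* The relation m + n t + 2 r = 0 makes [c] orthogonal to [y]; its entry - n makes it orthogonal to
   e_2 + e_3. *)
pose c : 'rV[F]_7 := vec7 (map intr [:: n; m; 0; - n; 0; 0; 1]).
have qc : qform c = (m * n + 1)%:~R by coords; rewrite rmorphD rmorphM /=; ring.
apply: (@good_criterion F L y (vec7 (map intr [:: 0; 0; 0; 0; 1; 0; 0]))
  (vec7 (map intr [:: 0; 0; 0; 0; 0; 1; 0])) (vec7 (map intr [:: 0; 0; 0; 1; 0; 0; 0]))
  (vec7 (map intr [:: 0; 1; 1; 0; 0; 0; 0])) c) => //;
  try (by coords; rewrite ?rmorphN /=; ring);
  try (by apply: good_for_rational => //;
    [coords; ring | exact: rational_vec7 | coords; ring]).
- by rewrite qc.
- apply: good_for_rational => //.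
  + by rewrite qc; coords; rewrite ?rmorphN rmorphD rmorphM /=; ring.
  + have -> : c + vec7 [seq i%:~R | i <- [:: 0; 0; 0; 0; 1; 0; 0]] -
       qform c *: vec7 [seq i%:~R | i <- [:: 0; 0; 0; 0; 0; 1; 0]] =
       vec7 (map intr [:: n; m; 0; - n; 1; - (m * n + 1); 1]).
      by rewrite qc; vec7_eq; rewrite ?rmorphN ?rmorphD ?rmorphM /=; ring.
    exact: rational_vec7.
  + by rewrite qc; coords; rewrite rmorphN /= dm dt; ring.
move=> v; rewrite polarE; coords => yv.
(* First and last coordinates give v_1 = k0 + n j and v_7 = r k0 + j, a system of determinant 1 - n
   r. *)
pose k0 := (v#0 - n%:~R * v#6) / (1 - n%:~R * r).
pose j := (v#6 - r * v#0) / (1 - n%:~R * r).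
exists k0, v#4, (v#3 + k0 + n%:~R * j), v#5, v#2, j.
have v1 : v#1 = v#2 - t * v#0 - (r * v#6) *+ 2.
  by apply/eqP; rewrite -subr_eq0 -yv; apply/eqP; ring.
by vec7_eq; rewrite ?v1 ?rmorphN /= ?dm ?dt /k0 /j; field.
Qed.

Lemma good_line13_of_small_span (t r : F) : r ^+ 2 = - t ->
  good (vec7 [:: 1; t; 0; -1; 0; 0; r]) -> good (vec7 [:: 1; 0; t; 0; 0; 0; 0]).
Proof.
move=> rt gy L LL; set x := vec7 _; set y := vec7 _ in gy.
have dt : t = - r ^+ 2 by rewrite rt opprK.
have qx : qform x = 0 by coords; ring.
have qy : qform y = 0 by coords; rewrite dt; ring.
case: (LL) => _ L2 _ L4 _.
(* The sign makes this vector pair to 1 with e_3. *)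
have Ly : L x (- 1 *: y).
  by apply: collinearity_scale => //; apply: L2; apply: gy => //; coords; ring.
(* Such [w] is orthogonal to the good vectors e_1 and e_3, so the pencil on [w] contains [x]. *)
have Lw w : qform w = 0 -> w#1 = 0 -> w#3 = 0 -> L x w.
  move=> qw w1 w3; apply: L2.
  pose e1 : 'rV[F]_7 := vec7 (map intr [:: 1; 0; 0; 0; 0; 0; 0]).
  pose e3 : 'rV[F]_7 := vec7 (map intr [:: 0; 0; 1; 0; 0; 0; 0]).
  have -> : x = 1 *: e1 + t *: e3 by vec7_eq; ring.
  apply: L4; last by coords; ring.
  - by apply: good_for_rational => //; [coords; ring | exact: rational_vec7 |
      rewrite polarE; coords; rewrite w1; ring].
  - by apply: good_for_rational => //; [coords; ring | exact: rational_vec7 |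
      rewrite polarE; coords; rewrite w3; ring].
(* The entry 2 r makes [c] orthogonal to [y]. *)
pose c : 'rV[F]_7 := vec7 [:: 0; 0; r *+ 2; 0; 0; 0; 1].
have qc : qform c = 1 by coords; ring.
apply: (@good_criterion F L x (vec7 [:: 0; 0; 0; 0; 1; 0; 0])
  (vec7 [:: 0; 0; 0; 0; 0; 1; 0]) (vec7 [:: 0; 0; 1; 0; 0; 0; 0]) (- 1 *: y) c) => //;
  try (by coords; ring);
  try (by apply: Lw; coords; ring).
- by rewrite qc oner_eq0.
move=> v; rewrite polarE; coords => xv.
have v1 : v#1 = - (t * v#3).
  by apply/eqP; rewrite -subr_eq0 -xv; apply/eqP; ring.
pose j := v#6 + r * v#3.
exists (v#0 + v#3), v#4, (v#2 - (v#0 + v#3) * t - (r * j) *+ 2), v#5, v#3, j.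
by vec7_eq; rewrite ?v1 /j; ring.
Qed.

Lemma swap_hyperbolic_vec7 (x0 x1 x2 x3 x4 x5 x6 : F) :
  swap_hyperbolic (vec7 [:: x0; x1; x2; x3; x4; x5; x6]) =
  vec7 [:: x1; x0; x2; x3; x4; x5; x6].
Proof. by vec7_eq. Qed.

Lemma swap_pairs12_vec7 (x0 x1 x2 x3 x4 x5 x6 : F) :
  swap_pairs12 (vec7 [:: x0; x1; x2; x3; x4; x5; x6]) =
  vec7 [:: x2; x3; x0; x1; x4; x5; x6].
Proof. by vec7_eq. Qed.

Lemma swap_pairs13_vec7 (x0 x1 x2 x3 x4 x5 x6 : F) :
  swap_pairs13 (vec7 [:: x0; x1; x2; x3; x4; x5; x6]) =
  vec7 [:: x4; x5; x2; x3; x0; x1; x6].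
Proof. by vec7_eq. Qed.

(** Swaps carry the first four vectors to e_1 + t e_3; the fifth is the image of the first under
    [siegel 1]. *)
Lemma good_lines_through_e2 (t : F) :
  (forall s : F, good (vec7 [:: 1; 0; s; 0; 0; 0; 0])) ->
  forall s, s \in [:: [:: 1; 0; 0; 0; 0]; [:: 0; 1; 0; 0; 0];
       [:: 0; 0; 1; 0; 0]; [:: 0; 0; 0; 1; 0]; [:: 1; -1; 0; 0; 1]] ->
     good (vec7 [:: 0, t & s]).
Proof.
move=> gs s.
have g1 : good (vec7 [:: 0; t; 1; 0; 0; 0; 0]).
  apply: good_swap_hyperbolic; rewrite swap_hyperbolic_vec7.
  by apply: good_swap_pairs12; rewrite swap_pairs12_vec7.
have g2 : good (vec7 [:: 0; t; 0; 1; 0; 0; 0]).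
  apply: good_swap_pairs12; rewrite swap_pairs12_vec7.
  apply: good_swap_hyperbolic; rewrite swap_hyperbolic_vec7.
  by apply: good_swap_pairs12; rewrite swap_pairs12_vec7.
have g3 : good (vec7 [:: 0; t; 0; 0; 1; 0; 0]).
  apply: good_swap_pairs12; rewrite swap_pairs12_vec7.
  apply: good_swap_pairs13; rewrite swap_pairs13_vec7.
  by apply: good_swap_pairs12; rewrite swap_pairs12_vec7.
have g4 : good (vec7 [:: 0; t; 0; 0; 0; 1; 0]).
  apply: good_swap_pairs13; rewrite swap_pairs13_vec7.
  apply: good_swap_hyperbolic; rewrite swap_hyperbolic_vec7.
  by apply: good_swap_pairs13; rewrite swap_pairs13_vec7.
have g5 : good (vec7 [:: 0; t; 1; -1; 0; 0; 1]).
  have -> : vec7 [:: 0; t; 1; -1; 0; 0; 1] = siegel 1 (vec7 [:: 0; t; 1; 0; 0; 0; 0]).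
    by vec7_eq; ring.
  exact: good_isometry (siegelP F 1) g1.
by rewrite !inE => /or4P[|||/orP[|]] /eqP->.
Qed.

Lemma good_singular : (forall s : F, good (vec7 [:: 1; 0; s; 0; 0; 0; 0])) ->
  forall x, qform x = 0 -> good x.
Proof.
move=> gs; apply: first_coord_ind => [x|x|x||x qx x0 L LL].
- exact: good_swap_hyperbolic.
- exact: good_swap_pairs12.
- exact: good_swap_pairs13.
- exact: good0.
apply: good_for_line_proj => // s hs; case: (LL) => _ L2 _ _ _.
(* The projection is t e_2 + (0, 0, s) for some t; its own goodness gives the line to [x] by
   symmetry. *)
have g : good (line_proj x s) by exact: good_lines_through_e2.
apply: L2; apply: g => //; rewrite polarC.
by move: hs; rewrite !inE => /or4P[|||/orP[|]] /eqP->; exact: polar_line_proj.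
Qed.

End GoodPoints.

(** * Characteristic 2 and order 9 *)

Section SmallFields.
Variable F : fieldType.

(** In characteristic 2, e_7 is in the radical of the polar form, so m = n = 0 and c = e_7 always
    work. *)
Lemma good_line13_char2 (r : F) : 2 \in [pchar F] ->
  good (vec7 [:: 1; 0; r ^+ 2; 0; 0; 0; 0]).
Proof.
move=> F2; have rt : r ^+ 2 = - r ^+ 2 by rewrite oppr_pchar2.
apply: (good_line13_of_small_span rt); apply: (good_small_span (m := 0) (n := 0) rt).
- by rewrite mul0r !add0r mulr2n addrr_pchar2.
- by rewrite oner_eq0.
Qed.

Lemma good_line13_order9 (s : F) : 3 \in [pchar F] -> s ^+ 9 = s ->
  good (vec7 [:: 1; 0; s; 0; 0; 0; 0]).
Proof.
move=> F3 s9; have three0 : 3%:R = 0 :> F := pcharf0 F3.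
have two : 2%:R = -1 :> F by apply/eqP; rewrite -addr_eq0 natr1 three0.
have two' (u : F) : u *+ 2 = - u by rewrite -mulr_natr two mulrN1.
have g (t : F) : t ^+ 3 = - t -> good (vec7 [:: 1; 0; t; 0; 0; 0; 0]).
  have [-> _|t0 t3] := eqVneq t 0.
    apply: good_rational; first by coords; ring.
    exact: (@rational_vec7 F [:: 1; 0; 0; 0; 0; 0; 0]).
  have t2 : t ^+ 2 = -1 by apply: (mulfI t0); rewrite -exprS t3 mulrN1.
  (* For r = 1 + t one has 1 + t + 2 r = 0 in characteristic 3, whence m = n = 1 below. *)
  have rt : (1 + t) ^+ 2 = - t by rewrite sqrrD t2 expr1n mul1r two' addrAC subrr add0r.
  apply: (good_line13_of_small_span rt); apply: (good_small_span (m := 1) (n := 1) rt).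
  - by rewrite mul1r two' subrr.
  - by rewrite [_%:~R]two oppr_eq0 oner_eq0.
(* [s ^ 9 = s] says that [u := s ^ 3 - s] satisfies [u ^ 3 = - u], and then
   [s - u] is fixed by the Frobenius map, hence lies in the prime field. *)
have cube (u v : F) : (u - v) ^+ 3 = u ^+ 3 - v ^+ 3.
  have -> : (u - v) ^+ 3 = u ^+ 3 - v ^+ 3 + 3%:R * (u * v * (v - u)) by ring.
  by rewrite three0 mul0r addr0.
pose u := s ^+ 3 - s.
have u3 : u ^+ 3 = - u by rewrite cube -exprM s9 opprB.
have prime_field (n : F) : n ^+ 3 = n -> exists m : int, n = m%:~R.
  move=> n3; have /eqP : n * (n - 1) * (n + 1) = 0.
    by rewrite -mulrA -subr_sqr expr1n mulrBr -exprS mulr1 n3 subrr.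
  rewrite !mulf_eq0 subr_eq0 addr_eq0 => /orP[/orP[]|] /eqP ->.
  - by exists 0.
  - by exists 1.
  - by exists (-1).
have [|m mn] := prime_field (s - u).
  by rewrite cube u3 opprK -{1}[s ^+ 3](subrK s) -/u addrAC -mulr2n two' addrC.
have := good_isometry (shiftP F m) (g u u3).
set v := (X in good X); suff -> : v = vec7 [:: 1; 0; s; 0; 0; 0; 0] by [].
by rewrite /v; vec7_eq; rewrite -?mn; ring.
Qed.

End SmallFields.

(** * Totally singular spans and their ranks *)

Section Spans.
Variable F : finFieldType.
Implicit Types x y z v w : 'rV[F]_7.

Lemma row_in_span2 x y v : (v <= x + y)%MS -> exists k l, v = k *: x + l *: y.
Proof.
case/sub_addsmxP=> [[a b] /= ->]; exists (a 0 0), (b 0 0).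
by rewrite [a]mx11_scalar [b]mx11_scalar !mul_scalar_mx !mxE eqxx !mulr1n.
Qed.

Lemma tot_sing_span3 x y z :
  qform x = 0 -> qform y = 0 -> qform z = 0 ->
  polar x y = 0 -> polar x z = 0 -> polar y z = 0 -> tot_sing (x + y + z)%MS.
Proof.
move=> qx qy qz xy xz yz; apply/forallP=> v; apply/implyP.
case/sub_addsmxP=> [[a b] /= ->].
have [k [l ->]] := row_in_span2 (submxMl a (x + y)%MS).
rewrite [b]mx11_scalar mul_scalar_mx qformD qformZ qform_comb polarZ !(polarDl, polarZl).
by rewrite qx qy qz xy xz yz !(mulr0, addr0).
Qed.

Lemma tot_sing_sub (A B : 'M[F]_7) : (A <= B)%MS -> tot_sing B -> tot_sing A.
Proof.
move=> AB /forallP h; apply/forallP=> v; apply/implyP=> vA.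
by have /implyP := h v; apply; apply: submx_trans AB.
Qed.

Lemma tot_sing_span2 x y :
  qform x = 0 -> qform y = 0 -> polar x y = 0 -> tot_sing (x + y)%MS.
Proof.
move=> qx qy xy; have xx : polar x x = 0 by rewrite polarxx qx mul0rn.
have yx : polar y x = 0 by rewrite polarC.
by apply: tot_sing_sub (tot_sing_span3 qx qy qx xy xx yx); apply: addsmxSl.
Qed.

Lemma eq_genmx_rank m n k (A : 'M[F]_(m, k)) (B : 'M[F]_(n, k)) :
  (A <= B)%MS -> \rank A = \rank B -> <<A>>%MS = <<B>>%MS.
Proof. by move=> AB rAB; apply/genmxP; rewrite -(mxrank_leqif_eq AB) rAB. Qed.

Lemma rank_adds_rV m (A : 'M[F]_(m, 7)) v : (\rank (A + v)%MS <= (\rank A).+1)%N.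
Proof.
rewrite (leq_trans (mxrank_adds_leqif A v)) // rank_rV.
by case: (v != 0); rewrite /= ?addn0 ?addn1 ?leqnSn.
Qed.

Lemma rank_span2 x y : (\rank (x + y)%MS <= 2)%N.
Proof. by rewrite (leq_trans (rank_adds_rV _ _)) // rank_rV; case: (x != 0). Qed.

Lemma Q2points_span2 x y : qform x = 0 -> qform y = 0 -> polar x y = 0 ->
  \rank (x + y)%MS = 2 -> <<(x + y)%MS>>%MS \in Q2points F.
Proof.
move=> qx qy xy rxy; rewrite inE /is_subsp genmx_id eqxx mxrank_gen rxy eqxx /=.
by apply: tot_sing_sub (tot_sing_span2 qx qy xy); rewrite genmxE.
Qed.

End Spans.

(** * The collinearity relation of a subspace of Q_2 *)

Section SpanIn.
Variables (F : finFieldType) (S : {set 'M[F]_7}).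
Implicit Types x y z v w : 'rV[F]_7.

Definition span_in x y : Prop :=
  [/\ qform x = 0, qform y = 0, polar x y = 0
    & \rank (x + y)%MS = 2 -> <<(x + y)%MS>>%MS \in S].

(** For independent x, y, z the points x y and x z lie on the line of Q_2 between <x> and <x, y, z>,
    which [S] then contains. In rank 2, one of x y and x z is already the whole span. *)
Lemma span_in_pencil x y z k l : Q2subspace S ->
  span_in x y -> span_in x z -> polar y z = 0 -> span_in x (k *: y + l *: z).
Proof.
move=> subS [qx qy xy Sy] [_ qz xz Sz] yz; set w := _ + _.
have qw : qform w = 0 by rewrite qform_comb qy qz yz !mulr0 !addr0.
have xw : polar x w = 0 by rewrite polar_comb xy xz !mulr0 addr0.
split=> // rxw.
pose Y := (x + y + z)%MS.
have xY : (x <= Y)%MS by rewrite /Y -addsmxA addsmxSl.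
have yY : (y <= Y)%MS by rewrite /Y (addsmxC x) -addsmxA addsmxSl.
have zY : (z <= Y)%MS by rewrite addsmxSr.
have wY : (w <= Y)%MS by rewrite addmx_sub ?scalemx_sub.
have span2Y v : (v <= Y)%MS -> (x + v <= Y)%MS by move=> vY; rewrite addsmx_sub xY.
have YC : Y = (x + z + y)%MS by rewrite /Y -!addsmxA (addsmxC y).
have x0 : x != 0.
  apply: contraTneq isT => x0; move: rxw; rewrite x0 adds0mx rank_rV.
  by case: (w != 0).
have YS : (\rank Y <= (\rank (x + y)%MS).+1)%N by apply: rank_adds_rV.
have YS' : (\rank Y <= (\rank (x + z)%MS).+1)%N by rewrite YC rank_adds_rV.
have [rY|rY] := ltnP 2 (\rank Y).
  have rxy : \rank (x + y)%MS = 2%N.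
    by apply/eqP; rewrite eqn_leq rank_span2 -ltnS (leq_trans rY).
  have rxz : \rank (x + z)%MS = 2%N.
    by apply/eqP; rewrite eqn_leq rank_span2 -ltnS (leq_trans rY).
  have rY3 : \rank Y = 3%N by apply/eqP; move: YS; rewrite eqn_leq rY rxy => ->.
  have tY : tot_sing Y by apply: tot_sing_span3.
  have lP : is_Q2line (Q2line <<x>>%MS Y).
    exists <<x>>%MS, Y; rewrite !genmxE rank_rV x0; split=> //.
    by split=> //; apply: tot_sing_sub tY; rewrite genmxE.
  have on_l v : qform v = 0 -> polar x v = 0 -> \rank (x + v)%MS = 2 -> (v <= Y)%MS ->
      <<(x + v)%MS>>%MS \in Q2line <<x>>%MS Y.
    move=> qv xv rv vY; rewrite inE Q2points_span2 //= !genmxE addsmxSl.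
    exact: span2Y.
  have/(subS _ lP)/subsetP : (1 < #|Q2line <<x>>%MS Y :&: S|)%N.
    apply/card_gt1P; exists <<(x + y)%MS>>%MS, <<(x + z)%MS>>%MS.
    split; [by rewrite inE on_l ?Sy | by rewrite inE on_l ?Sz |].
    (* If the two points coincided, [z] would lie in <x, y> and [Y] would have rank 2. *)
    apply: contraTneq rY => /genmxP/andP[_ h]; rewrite -leqNgt -[X in (_ <= X)%N]rxy; apply: mxrankS.
    by rewrite addsmx_sub submx_refl (submx_trans _ h) ?addsmxSr.
  by apply; apply: on_l.
have rY2 : \rank Y = 2%N.
  by apply/eqP; rewrite eqn_leq rY; have := mxrankS (span2Y w wY); rewrite rxw.
have -> : <<(x + w)%MS>>%MS = <<Y>>%MS by apply: eq_genmx_rank; rewrite ?span2Y ?rxw.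
have [rxy|rxy] := eqVneq (\rank (x + y)%MS) 2%N.
  have <- : <<(x + y)%MS>>%MS = <<Y>>%MS by apply: eq_genmx_rank; rewrite ?span2Y ?rxy.
  exact: Sy.
have [rxz|rxz] := eqVneq (\rank (x + z)%MS) 2%N.
  have <- : <<(x + z)%MS>>%MS = <<Y>>%MS by apply: eq_genmx_rank; rewrite ?span2Y ?rxz.
  exact: Sz.
have dep v : \rank (x + v)%MS != 2%N -> (v <= x)%MS.
  move=> rv; have r1 : \rank (x + v)%MS = \rank x.
    apply/eqP; rewrite eqn_leq (mxrankS (addsmxSl x v)) andbT.
    by rewrite [X in (_ <= X)%N]rank_rV x0 -ltnS ltn_neqAle rv rank_span2.
  by move/esym/(eq_genmx_rank (addsmxSl x v))/genmxP/andP: r1 => [_]; rewrite addsmx_sub => /andP[].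
suff : (\rank Y <= \rank x)%N by rewrite rY2 rank_rV x0.
by apply: mxrankS; rewrite !addsmx_sub submx_refl !dep.
Qed.

(** Reduction modulo p is invisible in [F]; [Fp_cast] identifies the modulus built into ['F_p] with
    [p]. *)
Lemma Fp_emb_zmod_morphism p : p \in [pchar F] -> zmod_morphism (@Fp_emb F p).
Proof.
move=> Fp a b; have pp := pcharf_prime Fp.
have embD (c d : 'F_p) : Fp_emb F (c + d) = Fp_emb F c + Fp_emb F d :> F.
  rewrite /Fp_emb -natrD -[RHS](GRing.natr_mod_pchar Fp).
  exact: (congr1 (fun m => ((c + d) %% m)%N%:R : F) (Fp_cast pp)).
by apply/eqP; rewrite eq_sym subr_eq -embD subrK.
Qed.

Lemma Fp_emb_monoid_morphism p : p \in [pchar F] -> monoid_morphism (@Fp_emb F p).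
Proof.
move=> Fp; have pp := pcharf_prime Fp; split=> [|a b].
  by rewrite /Fp_emb /= modn_small // (Fp_cast pp) prime_gt1.
rewrite /Fp_emb -natrM -[RHS](GRing.natr_mod_pchar Fp).
exact: (congr1 (fun m => ((a * b) %% m)%N%:R : F) (Fp_cast pp)).
Qed.

Lemma Fp_emb_rmorphism p : p \in [pchar F] ->
  exists f : {rmorphism 'F_p -> F}, forall a, Fp_emb F a = f a.
Proof.
move=> Fp.
pose m1 := GRing.isZmodMorphism.Build _ _ _ (Fp_emb_zmod_morphism Fp).
pose m2 := GRing.isMonoidMorphism.Build _ _ _ (Fp_emb_monoid_morphism Fp).
by exists (HB.pack (@Fp_emb F p) m1 m2 : {rmorphism 'F_p -> F}).
Qed.

(** Integer vectors reduce modulo p, and injectivity of the embedding [f] carries rank and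
    singularity back to ['F_p]. *)
Lemma span_in_rational p x y : p \in [pchar F] -> Fp_points F p \subset S ->
  rational_vec x -> rational_vec y ->
  qform x = 0 -> qform y = 0 -> polar x y = 0 -> span_in x y.
Proof.
move=> Fp /subsetP FpS [s0 ds] [t0 dt]; have [f fE] := Fp_emb_rmorphism Fp.
pose s : 'rV['F_p]_7 := map_mx intr s0; pose t : 'rV['F_p]_7 := map_mx intr t0.
have {ds} -> : x = map_mx f s by apply/rowP=> i; rewrite ds !mxE rmorph_int.
have {dt} -> : y = map_mx f t by apply/rowP=> i; rewrite dt !mxE rmorph_int.
have fq (v : 'rV['F_p]_7) : qform (map_mx f v) = f (qform v).
  by rewrite /qform !mxE !rmorphD !rmorphM.
have fp (u v : 'rV['F_p]_7) : polar (map_mx f u) (map_mx f v) = f (polar u v).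
  by rewrite /polar !rmorphB /= -!fq map_mxD.
move=> qs qt st; split=> // rst; apply: FpS.
have eq_st := map_addsmx f s t.
apply/imsetP; exists (s + t)%MS; last first.
  by rewrite (eq_map_mx _ fE); apply/esym/eq_genmx.
have f0 a : f a = 0 -> a = 0 by move/eqP; rewrite fmorph_eq0 => /eqP.
move: rst; rewrite -eq_st mxrank_map inE => ->; rewrite eqxx /=.
apply: tot_sing_span2; apply: f0.
- by rewrite -fq.
- by rewrite -fq.
- by rewrite -fp.
Qed.

Lemma span_in_collinearity p : p \in [pchar F] -> Fp_points F p \subset S ->
  Q2subspace S -> collinearity span_in.
Proof.
move=> Fp FpS subS; split=> [x y [] //|x y [qx qy xy Sxy]|x qx|x y z k l|x y].
- by split=> //; rewrite ?(polarC y) // addsmxC.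
- split=> //; first by rewrite polarxx qx mul0rn.
  by rewrite (addsmx_idPl (submx_refl x)) rank_rV; case: (x != 0).
- exact: span_in_pencil.
- exact: span_in_rational FpS.
Qed.

End SpanIn.

(** * The three fields, and from good vectors to generation *)

Lemma good_line13_small_field (F : finFieldType) (t : F) :
  #|F| \in [:: 4; 8; 9]%N -> good (vec7 [:: 1; 0; t; 0; 0; 0; 0]).
Proof.
rewrite !inE => /or3P[] /eqP cF.
- have F2 : 2 \in [pchar F] by apply: (@card_finPcharP _ 2 2).
  (* Every t is a square: t = (t^2)^2 since t^4 = t, and likewise t = (t^4)^2 in order 8. *)
  have := good_line13_char2 (r := t ^+ 2) F2.
  by rewrite -exprM -[(2 * 2)%N]cF expf_card.
- have F2 : 2 \in [pchar F] by apply: (@card_finPcharP _ 2 3).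
  have := good_line13_char2 (r := t ^+ 4) F2.
  by rewrite -exprM -[(4 * 2)%N]cF expf_card.
- apply: good_line13_order9; first exact: (@card_finPcharP _ 3 2).
  by rewrite -[9%N]cF expf_card.
Qed.

(** A point [A] of Q_2 is spanned by two basis rows; goodness of one, applied to the collinearity of
    [S], puts [A] in [S]. *)
Lemma generated_of_good (F : finFieldType) (p : nat) : p \in [pchar F] ->
  (forall x : 'rV[F]_7, qform x = 0 -> good x) -> generated_over_prime F p.
Proof.
move=> Fp gs S SQ FpS subS; apply/eqP; rewrite eqEsubset SQ; apply/subsetP=> A.
have LL := span_in_collinearity Fp FpS subS.
rewrite inE => /and3P[/eqP genA /eqP rA /forallP tA].
have qA v : (v <= A)%MS -> qform v = 0 by move=> vA; apply/eqP; move: (tA v); rewrite vA.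
pose B := row_base A; have BA i : (row i B <= A)%MS.
  by rewrite (submx_trans (row_sub i B)) ?eq_row_base.
pose i1 : 'I_(\rank A) := cast_ord (esym rA) (Ordinal (isT : 1 < 2)%N).
pose i2 : 'I_(\rank A) := cast_ord (esym rA) (Ordinal (isT : 0 < 2)%N).
pose x := row i2 B; pose y := row i1 B.
have [_ _ _] : span_in S x y.
  apply: (gs x (qA _ (BA _)) _ LL); first exact: qA (BA i1).
  by rewrite /polar !qA ?subr0 // ?addmx_sub ?BA.
have dA : <<(x + y)%MS>>%MS = <<A>>%MS.
  apply/genmxP; rewrite addsmx_sub !BA /= -(eq_row_base A).
  apply/row_subP=> i; have : i = i2 \/ i = i1.
    case: i => [[|[|m]] Hm]; [left|right|]; try exact: val_inj.
    by exfalso; move: Hm; rewrite rA.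
  by case=> ->; [exact: addsmxSl | exact: addsmxSr].
by rewrite dA -genA; apply; rewrite -mxrank_gen dA mxrank_gen.
Qed.

Local Close Scope ring_scope.

Theorem mainTheorem7 (F : finFieldType) (p : nat) :
  prime p -> (p \in [pchar F])%R -> #|F| \in [:: 4; 8; 9] ->
  generated_over_prime F p.
Proof.
move=> _ Fp cF; apply: generated_of_good => //; apply: good_singular => t.
exact: good_line13_small_field.
Qed.
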